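(* Let $\varphi$ be an LTL formula over $V$ with decomposition $\langle\varphi_1,\dots,\varphi_n\rangle$. (1) Let $\mathcal{G}=\langle g_1,\dots,g_n\rangle$ be guarantee transition systems, let $\mathcal{G}_i=\{g_j\mid j\ne i\}$, and let $\mathcal{S}=\langle s_1,\dots,s_n\rangle$ where each $s_i$ is a local strategy with respect to $\mathcal{G}_i$. If $(\mathcal{S},\mathcal{G})$ is a solution of certifying synthesis with local strategies for $\varphi$, then $s_1\parallel\cdots\parallel s_n\models\varphi$. (2) Let $\mathcal{S}=\langle s_1,\dots,s_n\rangle$ be (complete) strategies. If $s_1\parallel\cdots\parallel s_n\models\varphi$ and $\mathrm{prop}(\varphi_i)\subseteq V_i$ for all $i$, then there exists a vector $\mathcal{G}$ of guarantee transition systems such that $(\mathcal{S}',\mathcal{G})$ is a solution of certifying synthesis with local strategies for $\varphi$, where $\mathcal{S}'=\langle s'_1,\dots,s'_n\rangle$ and $s'_i$ is the restriction of $s_i$ to $\mathcal{G}$.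
   Context: An architecture consists of an environment process $env$ with output variables $O_{env}$ and $n\ge 2$ system processes $p_1,\dots,p_n$, a finite set $V$ of variables, and for each $p_i$ an input set $I_i\subseteq V$ and output set $O_i\subseteq V$ with $I_i\cap O_i=\emptyset$ and $O_j\cap O_k=\emptyset$ for $j\ne k$. Let $V_i=I_i\cup O_i$, $V=\bigcup_i V_i$, $inp=\bigcup_i I_i$, $out=\bigcup_i O_i$. Intersections/unions of words are letterwise (unions of a finite and an infinite word are truncated to the finite length); $\sigma_{[t]}$ is the length-$t$ prefix, $\sigma_k$ the $k$-th letter; $\mathrm{prop}(\chi)$ is the set of atomic propositions of $\chi$. A (Moore) transition system over inputs $I$ and outputs $O$ is $(T,t_0,\tau,o)$ with finite $T$, transition function $\tau:T\times 2^I\to T$ (possibly partial, see below), $o:T\to 2^O$; on $\gamma\in(2^I)^\omega$ it visits $t_0t_1\dots$ with $t_{k+1}=\tau(t_k,\gamma_k)$ and produces the trace $(\gamma_0\cup o(t_0))(\gamma_1\cup o(t_1))\dots$, which is finite if an undefined transition is reached. A strategy $s_i$ for $p_i$ is a transition system over $I_i,O_i$ with total $\tau$; $comp(s_i,\gamma)$ is its trace. The computation of $s_1\parallel\cdots\parallel s_n$ on $\gamma\in(2^{O_{env}})^\omega$ is the word $\sigma$ with $\sigma\cap O_{env}=\gamma$ and $\sigma\cap O_i=comp(s_i,\sigma\cap I_i)\cap O_i$ (each process reading its inputs from the environment and the current outputs of the others), continued as long as all transitions are defined; $s_1\parallel\cdots\parallel s_n\models\varphi$ means that for every $\gamma$ this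 computation is infinite and satisfies $\varphi$. Decomposition: $\varphi=\xi_1\wedge\dots\wedge\xi_k$ with atomic propositions in $V$; $\varphi_i$ is the conjunction of the $\xi_j$ with $\mathrm{prop}(\xi_j)\cap O_i\ne\emptyset$ or $\mathrm{prop}(\xi_j)\cap out=\emptyset$. GTS: $O^G_i=O_i\cap inp$; a guarantee transition system $g_i$ is a transition system over $I_i$ and $O^G_i$ with total $\tau$. For a set $\mathcal{G}'$ of GTS, $\sigma\in(2^V)^*$ of length $t$ is a valid history w.r.t. $\mathcal{G}'$ if for all $g_j\in\mathcal{G}'$, $1\le k\le t$, and infinite extensions $\hat\sigma$ of $\sigma$: $\sigma_k\cap O^G_j=comp(g_j,\hat\sigma\cap I_j)_k\cap O^G_j$. Simulation $s\preceq_{O^G_i}g_i$: a relation between states of $s$ and $g_i$ containing the initial pair, whose pairs have outputs agreeing on $O^G_i$, and such that whenever $(t,u)$ is related and $s$ has a transition from $t$ on input $\iota$, the $\iota$-successors are related. Local strategy: a local strategy $s_i$ for $p_i$ with respect to a set $\mathcal{G}'$ of GTS is a transition system over $I_i,O_i$ with partial transition function whose domain is such that $comp(s_i,\gamma)$ is infinite iff there exists $\gamma'\in(2^{V\setminus V_i})^\omega$ with $comp(s_i,\gamma)_{[t]}\cup\gamma'_{[t]}$ a valid history w.r.t. $\mathcal{G}'$ for all $t$. Restriction: the restriction of a complete strategy $s_i$ to $\mathcal{G}$ is the local strategy w.r.t. $\mathcal{G}_i=\{g_j\mid j\ne i\}$ obtained as a copy of $s_i$ with transitions removed so that each of its computations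 is a prefix of the corresponding computation of $s_i$, and $comp(s'_i,\gamma)$ is infinite iff there exists $\gamma'\in(2^{V\setminus V_i})^\omega$ with $comp(s'_i,\gamma)_{[t]}\cup\gamma'_{[t]}$ a valid history w.r.t. $\mathcal{G}_i$ for all $t$. A universal co-Büchi automaton $(Q,q_0,\delta,F)$ accepts a word iff all its runs visit $F$ only finitely often. Certifying synthesis with local strategies: $(\mathcal{S},\mathcal{G})$ is a solution if for all $i$, $s_i$ is a local strategy w.r.t. $\mathcal{G}_i$, $s_i\preceq_{O^G_i}g_i$, and for all $\gamma\in(2^{I_i})^\omega$, $\gamma'\in(2^{V\setminus V_i})^\omega$, every run (finite or infinite) of $\mathcal{A}_i$ on $comp(s_i,\gamma)\cup\gamma'$ visits rejecting states only finitely often, where $\mathcal{A}_i$ is a universal co-Büchi automaton with $\mathcal{L}(\mathcal{A}_i)=\mathcal{L}(\varphi_i)$.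
   Formalization: The restriction of a strategy is allowed to contain several copies of one state of the original (transitions then removed), since with the same state set the restriction need not exist; part (2) asserts that restrictions exist and that every vector of them forms a solution with G. *)

(* Defs.v *)
(* Library: Mathematical Components. *)
From mathcomp Require Import all_boot.
Set Implicit Arguments.
Unset Strict Implicit.
Unset Printing Implicit Defensive.

Section Words.
Variable V : finType.

Definition iword := nat -> {set V}.

(* A finite or infinite word; [None] marks the positions beyond its end.
   All the words built below have a downward closed domain. *)
Definition word := nat -> option {set V}.

Definition inf_word (w : iword) : word := fun k => Some (w k).
Definition is_infinite (w : word) : Prop := forall k, isSome (w k).

Definition over (D : {set V}) (w : iword) : Prop := forall k, w k \subset D.
Definition restr (w : iword) (D : {set V}) : iword := fun k => w k :&: D.

(* Letterwise union, truncated to the length of [w]. *)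
Definition wcup (w : word) (u : iword) : word :=
  fun k => omap (fun a => a :|: u k) (w k).

(* The prefix of length t (all of [w] if [w] is shorter than t). *)
Definition wprefix (w : word) (t : nat) : seq {set V} := pmap w (iota 0 t).

Definition prefix_word (u w : word) : Prop :=
  forall k a, u k = Some a -> w k = Some a.

End Words.

Section LTL.
Variable V : finType.

Inductive ltl : Type :=
| LTrue
| LAtom of V
| LNot of ltl
| LAnd of ltl & ltl
| LNext of ltl
| LUntil of ltl & ltl.

Fixpoint prop (f : ltl) : {set V} :=
  match f with
  | LTrue => set0
  | LAtom v => [set v]
  | LNot f1 => prop f1
  | LAnd f1 f2 => prop f1 :|: prop f2
  | LNext f1 => prop f1
  | LUntil f1 f2 => prop f1 :|: prop f2
  end.

Fixpoint sat_at (w : iword V) (k : nat) (f : ltl) : Prop :=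
  match f with
  | LTrue => True
  | LAtom v => v \in w k
  | LNot f1 => ~ sat_at w k f1
  | LAnd f1 f2 => sat_at w k f1 /\ sat_at w k f2
  | LNext f1 => sat_at w k.+1 f1
  | LUntil f1 f2 => exists2 m, k <= m & sat_at w m f2 /\
                      (forall j, k <= j -> j < m -> sat_at w j f1)
  end.

Definition sat (w : iword V) (f : ltl) : Prop := sat_at w 0 f.

Fixpoint conjs (xs : seq ltl) : ltl :=
  match xs with
  | [::] => LTrue
  | [:: x] => x
  | x :: xs' => LAnd x (conjs xs')
  end.

End LTL.
Arguments LTrue {V}.

Section CoBuchi.
Variable V : finType.

Record ucb_automaton : Type := UcbAutomaton {
  ucb_state : finType;
  ucb_init : ucb_state;
  ucb_delta : ucb_state -> {set V} -> ucb_state -> bool;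
  ucb_rej : {set ucb_state}
}.

(* A run may be finite or infinite; [None] marks the positions beyond its
   end.  A finite run need not be maximal, which is immaterial for the
   acceptance condition. *)
Definition is_run (A : ucb_automaton) (w : word V)
    (r : nat -> option (ucb_state A)) : Prop :=
  r 0 = Some (ucb_init A) /\
  forall k q', r k.+1 = Some q' ->
    exists q a, [/\ r k = Some q, w k = Some a & ucb_delta q a q'].

Definition fin_rejecting (A : ucb_automaton)
    (r : nat -> option (ucb_state A)) : Prop :=
  exists N, forall k q, N <= k -> r k = Some q -> q \notin ucb_rej A.

Definition all_runs_fin_rejecting (A : ucb_automaton) (w : word V) : Prop :=
  forall r, is_run w r -> @fin_rejecting A r.

Definition accepts (A : ucb_automaton) (w : iword V) : Prop :=
  all_runs_fin_rejecting A (inf_word w).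

Definition same_language (A : ucb_automaton) (f : ltl V) : Prop :=
  forall w : iword V, accepts A w <-> sat w f.

End CoBuchi.

Section TransitionSystems.
Variable V : finType.

(* [ts_step] is only meaningful on letters included in [I]; [None] means that
   the transition is undefined. *)
Record tsys (I O : {set V}) : Type := Tsys {
  ts_state : finType;
  ts_init : ts_state;
  ts_step : ts_state -> {set V} -> option ts_state;
  ts_out : ts_state -> {set V};
  ts_out_sub : forall t, ts_out t \subset O
}.

Record total_tsys (I O : {set V}) : Type := TotalTsys {
  total_ts :> tsys I O;
  ts_total : forall (t : ts_state total_ts) (a : {set V}),
    a \subset I -> isSome (ts_step t a)
}.

Fixpoint visit (I O : {set V}) (s : tsys I O) (g : iword V) (k : nat) :
    option (ts_state s) :=
  match k with
  | 0 => Some (ts_init s)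
  | k'.+1 => obind (fun t => ts_step t (g k')) (visit s g k')
  end.

Definition computation (I O : {set V}) (s : tsys I O) (g : iword V) : word V :=
  fun k => omap (fun t => g k :|: ts_out t) (visit s g k).

Definition simulated (I O O' OG : {set V}) (s : tsys I O) (g : tsys I O') :
    Prop :=
  exists R : ts_state s -> ts_state g -> Prop,
    R (ts_init s) (ts_init g) /\
    forall t u, R t u ->
      ts_out t :&: OG = ts_out u :&: OG /\
      forall (a : {set V}) t', a \subset I -> ts_step t a = Some t' ->
        exists2 u', ts_step u a = Some u' & R t' u'.

(* [s'] is a copy of [s] with transitions removed.  Several states of [s'] may
   be copies of one state of [s]: whether a transition has to be removed
   depends on the history and not only on the current state of [s]. *)
Definition copy_with_removals (I O : {set V}) (s s' : tsys I O) : Prop :=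
  exists h : ts_state s' -> ts_state s,
    [/\ h (ts_init s') = ts_init s,
        forall t, ts_out t = ts_out (h t) &
        forall t (a : {set V}) t', a \subset I -> ts_step t a = Some t' ->
          ts_step (h t) a = Some (h t')].

End TransitionSystems.

(* The process outputs are also disjoint from the environment outputs, env
   being one of the processes.  The type [V] is the set of all variables. *)
Record architecture (V : finType) (n : nat) : Type := Architecture {
  Oenv : {set V};
  Inp : 'I_n -> {set V};
  Out : 'I_n -> {set V};
  Inp_Out_disj : forall i, Inp i :&: Out i = set0;
  Out_Out_disj : forall j k, j != k -> Out j :&: Out k = set0;
  Oenv_Out_disj : forall i, Oenv :&: Out i = set0;
  vars_cover : \bigcup_(i < n) (Inp i :|: Out i) = [set: V]
}.

Section CertifyingSynthesis.
Variables (V : finType) (n : nat) (arch : architecture V n).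

Definition Var (i : 'I_n) : {set V} := Inp arch i :|: Out arch i.
Definition inp : {set V} := \bigcup_(i < n) Inp arch i.
Definition out : {set V} := \bigcup_(i < n) Out arch i.
Definition OutG (i : 'I_n) : {set V} := Out arch i :&: inp.

(* Transition systems that may be partial, as local strategies are. *)
Definition partial_strategy (i : 'I_n) := tsys (Inp arch i) (Out arch i).
Definition strategy (i : 'I_n) := total_tsys (Inp arch i) (Out arch i).
Definition gts (i : 'I_n) := total_tsys (Inp arch i) (OutG i).

Definition component (xs : seq (ltl V)) (i : 'I_n) : ltl V :=
  conjs [seq x <- xs |
         (prop x :&: Out arch i != set0) || (prop x :&: out == set0)].

(* [sg] is a computation of the parallel composition on [g]; [w] is an infinite
   extension of [sg], of which only the letters of [sg] matter.  The word [sg]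
   is unique if every variable is an output of some process or of the
   environment; other variables are left unconstrained. *)
Definition par_computation (S : forall i, partial_strategy i)
    (g : iword V) (sg : word V) : Prop :=
  exists w : iword V, forall k,
    if [forall i, isSome (computation (S i) (restr w (Inp arch i)) k)] then
      [/\ sg k = Some (w k),
          w k :&: Oenv arch = g k &
          forall i, Some (w k :&: Out arch i) =
            omap (fun a => a :&: Out arch i)
                 (computation (S i) (restr w (Inp arch i)) k)]
    else sg k = None.

Definition par_models (S : forall i, partial_strategy i) (f : ltl V) : Prop :=
  forall g : iword V, over (Oenv arch) g ->
  forall sg : word V, par_computation S g sg ->
    exists2 w : iword V, sg =1 inf_word w & sat w f.

(* Valid histories with respect to the set of all [G j] with [j \in J]. *)
Definition valid_history (J : {set 'I_n}) (G : forall j, gts j)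
    (h : seq {set V}) : Prop :=
  forall j k (w : iword V), j \in J -> k < size h ->
    (forall m, m < size h -> w m = nth set0 h m) ->
    Some (nth set0 h k :&: OutG j) =
      omap (fun a => a :&: OutG j)
           (computation (G j) (restr w (Inp arch j)) k).

Definition local_strategy (J : {set 'I_n}) (G : forall j, gts j) (i : 'I_n)
    (s : partial_strategy i) : Prop :=
  forall g : iword V, over (Inp arch i) g ->
    (is_infinite (computation s g) <->
     exists2 g' : iword V, over (~: Var i) g' &
       forall t, valid_history J G (wprefix (wcup (computation s g) g') t)).

Definition is_restriction (G : forall j, gts j) (i : 'I_n)
    (s : strategy i) (s' : partial_strategy i) : Prop :=
  [/\ copy_with_removals s s',
      forall g : iword V, over (Inp arch i) g ->
        prefix_word (computation s' g) (computation s g) &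
      local_strategy [set~ i] G s'].

Definition is_solution (A : 'I_n -> ucb_automaton V)
    (S : forall i, partial_strategy i) (G : forall i, gts i) : Prop :=
  forall i,
    [/\ local_strategy [set~ i] G (S i),
        simulated (OutG i) (S i) (G i) &
        forall g g' : iword V, over (Inp arch i) g -> over (~: Var i) g' ->
          all_runs_fin_rejecting (A i) (wcup (computation (S i) g) g')].

(* Parallel computations exist, so [par_models] is not vacuous. *)
Lemma par_computation_exists (S : forall i, partial_strategy i) (g : iword V) :
  over (Oenv arch) g -> exists sg, par_computation S g sg.
Proof.
move=> g_env.
pose outs (st : forall i, option (ts_state (S i))) : {set V} :=
  \bigcup_(i < n) odflt set0 (omap (@ts_out _ _ _ (S i)) (st i)).
pose st := fix st k : forall i, option (ts_state (S i)) :=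
  match k with
  | 0 => fun i => Some (ts_init (S i))
  | k'.+1 => fun i => obind
      (fun t => ts_step t ((g k' :|: outs (st k')) :&: Inp arch i)) (st k' i)
  end.
pose w : iword V := fun k => g k :|: outs (st k).
have visitE i k : visit (S i) (restr w (Inp arch i)) k = st k i.
  by elim: k => //= k ->.
pose def k := [forall i, isSome (computation (S i) (restr w (Inp arch i)) k)].
exists (fun k => if def k then Some (w k) else None), w => k.
rewrite -/(def k); case def_k: (def k) => //; move/forallP in def_k.
have st_k i : exists t, st k i = Some t.
  move: (def_k i); rewrite /computation visitE.
  by case: (st k i) => // t; exists t.
have outsP x : reflect (exists i t, st k i = Some t /\ x \in ts_out t)
                       (x \in outs (st k)).
  apply: (iffP bigcupP) => [[i _]|[i [t [E xt]]]]; last by exists i; rewrite ?E.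
  by have [t E] := st_k i; rewrite E /= => xt; exists i, t.
split=> [//||i].
  apply/setP=> x; rewrite !inE; apply/andP/idP => [[/orP[//|/outsP]]|gx].
    case=> i [t [_ xt]] xe; have /setP/(_ x) := Oenv_Out_disj arch i.
    by rewrite !inE xe (subsetP (ts_out_sub t) _ xt).
  by rewrite gx (subsetP (g_env k) _ gx).
have [t E] := st_k i; rewrite /computation visitE E /=; congr Some.
apply/setP=> x; rewrite !inE.
case xO: (x \in Out arch i); rewrite ?andbF ?andbT //.
have /negbTE-> : x \notin Inp arch i.
  by have /setP/(_ x) := Inp_Out_disj arch i; rewrite !inE xO andbT => ->.
have /negbTE-> : x \notin g k.
  apply/negP=> /(subsetP (g_env k)) xe.
  by have /setP/(_ x) := Oenv_Out_disj arch i; rewrite !inE xe xO.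
rewrite andbF /=; apply/outsP/idP => [[j [u [Eu xu]]]|xt]; last by exists i, t.
have [ji|ji] := eqVneq j i; first by subst j; move: Eu; rewrite E => -[->].
have /setP/(_ x) := Out_Out_disj arch ji.
by rewrite !inE xO (subsetP (ts_out_sub u) _ xu).
Qed.

End CertifyingSynthesis.

(* Main.v *)
(* (1) By induction on the length, no local strategy gets stuck in the parallel
   computation: a prefix on which all strategies are defined is, by simulation, a valid
   history for all guarantees, and it extends to an infinite valid word by letting each
   process j <> i follow g_j (which is total) and p_i follow s_i; so s_i, being a local
   strategy, has its next transition. The computation is therefore infinite, and every
   A_i accepts it.

   (2) Take for g_i the strategy s_i with its outputs cut down to O^G_i. The restriction
   of s_i runs along a subset construction on the joint states of all the strategies; a
   transition is kept as long as some valid history fits the inputs of p_i, and König's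
   lemma yields an infinite witness from the finite ones. An infinite computation of a
   restriction comes with a valid word, which is on V_i a parallel computation of the
   s_j, hence satisfies phi_i; finite computations are accepted trivially. *)
From mathcomp Require Import all_boot.
From Stdlib Require Import ClassicalEpsilon Classical_Pred_Type.
Require Import Defs.
Set Implicit Arguments.
Unset Strict Implicit.
Unset Printing Implicit Defensive.

(** * Words built from their prefixes, truncation, and König's lemma *)

Section Words.
Variable V : finType.
Implicit Types (w g : iword V) (F : seq {set V} -> {set V}).

Lemma unfold_word F : exists w, forall k, w k = F (mkseq w k).
Proof.
pose hs k := iter k (fun h => rcons h (F h)) [::].
exists (fun k => F (hs k)) => k; congr F.
by elim: k => //= k IH; rewrite mkseqS -IH.
Qed.

Lemma wprefixS (u : word V) t :
  wprefix u t.+1 = wprefix u t ++ seq_of_opt (u t).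
Proof. by rewrite /wprefix -addn1 iotaD pmap_cat /= add0n; case: (u t). Qed.

Lemma wprefix_mkseq (u : word V) w t :
  (forall k, k < t -> u k = Some (w k)) -> wprefix u t = mkseq w t.
Proof.
elim: t => // t IH uw; rewrite wprefixS mkseqS uw //= cats1 IH // => k kt.
by apply: uw; apply: ltnW.
Qed.

Lemma wprefix_truncate (u : word V) w t :
  (forall k a, u k = Some a -> a = w k) ->
  (forall k, u k = None -> u k.+1 = None) ->
  exists2 m, m <= t & wprefix u t = mkseq w m.
Proof.
move=> uw udown.
(* The induction has to know whether [u] has already stopped, in which case [m] stays fixed. *)
suff [m [mt E _]] : exists m, [/\ m <= t, wprefix u t = mkseq w m &
                              m = t \/ u t = None] by exists m.
elim: t => [|t [m [mt E]]]; first by exists 0; split=> //; left.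
rewrite wprefixS E; case ut: (u t) => [a|] /=; last first.
  by move=> _; exists m; split; rewrite ?cats0 ?(leqW mt) //; right; apply: udown.
case=> // ->; exists t.+1; split=> //; last by left.
by rewrite mkseqS cats1 (uw _ _ ut).
Qed.

(* König's lemma, for the tree of the words over the finite alphabet 2^V. *)
Lemma koenig (P : nat -> iword V -> Prop) :
  (forall k w, P k.+1 w -> P k w) ->
  (forall k w w', (forall m, m < k -> w m = w' m) -> P k w -> P k w') ->
  (forall k, exists w, P k w) ->
  exists w, forall k, P k w.
Proof.
move=> Pdown Pext Pex.
have Pmono m k w : m <= k -> P k w -> P m w.
  move=> mk; rewrite -(subnK mk); elim: (k - m) => // d IH /Pdown; exact: IH.
(* The good prefixes are the nodes with arbitrarily deep witnesses; the branch is built through them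
   only. *)
pose good h := forall k, exists2 w, P k w & forall m, m < size h -> w m = nth set0 h m.
have step h : exists a, good h -> good (rcons h a).
  have [gh|ngh] := classic (good h); last by exists set0.
  apply: NNPP => /not_ex_all_not noa.
  have bad a : exists k, ~ exists2 w, P k w &
      forall m, m < size (rcons h a) -> w m = nth set0 (rcons h a) m.
    by apply: not_all_ex_not => ga; apply: (noa a).
  have [f bad_f] := fin_all_exists bad.
  (* If every letter fails at some depth, a witness for the largest of these depths still extends
     [h], and its own next letter contradicts that failure. *)
  have [w Pw wh] := gh (\max_a f a).
  apply: (bad_f (w (size h))); exists w; first by apply: Pmono Pw; apply: leq_bigmax.
  move=> m; rewrite size_rcons ltnS nth_rcons leq_eqVlt => /orP[/eqP->|mh].
    by rewrite ltnn eqxx.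
  by rewrite mh wh.
have [F goodF] := choice _ step.
have [w wF] := unfold_word F; exists w => k.
have : good (mkseq w k).
  elim: k => [k|k IH]; first by have [u] := Pex k; exists u.
  by rewrite mkseqS wF; apply: goodF.
case/(_ k) => u Pu uw; apply: Pext Pu => m mk.
by rewrite uw ?size_mkseq // nth_mkseq.
Qed.

End Words.

(** * Satisfaction: dependence on the atoms, and conjunctions *)

Section LTL.
Variable V : finType.
Implicit Types (w : iword V) (f x : ltl V) (xs : seq (ltl V)).

Lemma sat_at_agree (D : {set V}) w w' f k :
  (forall k, w k :&: D = w' k :&: D) -> prop f \subset D ->
  sat_at w k f <-> sat_at w' k f.
Proof.
move=> ww'; elim: f k => //= [v|f IH|f1 IH1 f2 IH2|f IH|f1 IH1 f2 IH2] k.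
- by rewrite sub1set => vD; have /setP/(_ v) := ww' k; rewrite !inE vD !andbT => ->.
- by move=> fD; have := IH k fD; tauto.
- by rewrite subUset => /andP[f1D f2D]; have := IH1 k f1D; have := IH2 k f2D; tauto.
- exact: IH.
- rewrite subUset => /andP[f1D f2D].
  have E1 j := IH1 j f1D; have E2 j := IH2 j f2D.
  by split=> -[m km [s2 s1]]; exists m => //; split; [apply/E2| |apply/E2|];
    move=> // j kj jm; apply/E1; apply: s1.
Qed.

Lemma sat_conjs_cons w x xs :
  sat w (conjs (x :: xs)) <-> sat w x /\ sat w (conjs xs).
Proof. by case: xs => [|y xs]; rewrite /sat /=; tauto. Qed.

Lemma sat_conjs_filter w (p : pred (ltl V)) xs :
  sat w (conjs xs) -> sat w (conjs (filter p xs)).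
Proof.
elim: xs => // x xs IH /sat_conjs_cons[sx /IH sxs] /=.
by case: (p x) => //; apply/sat_conjs_cons.
Qed.

Lemma sat_conjs_cover (I : Type) w (p : I -> pred (ltl V)) xs :
  (forall x, exists i, p i x) ->
  (forall i, sat w (conjs (filter (p i) xs))) -> sat w (conjs xs).
Proof.
move=> pcover; elim: xs => // x xs IH sp; apply/sat_conjs_cons; split.
  by have [i pix] := pcover x; have := sp i; rewrite /= pix => /sat_conjs_cons[].
by apply: IH => i; have := sp i; rewrite /=; case: (p i x) => // /sat_conjs_cons[].
Qed.

End LTL.

(** * Runs and outputs of transition systems *)

Section TransitionSystems.
Variables (V : finType) (I O : {set V}).
Implicit Types (w g : iword V).

(** Set-valued, so that output equations need no options; the default [set0] stands for a run that
    has stopped. *)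
Definition out_at (s : tsys I O) g k : {set V} := oapp (@ts_out V I O s) set0 (visit s g k).

Lemma out_at_sub (s : tsys I O) g k : out_at s g k \subset O.
Proof. by rewrite /out_at; case: (visit s g k) => [t|] /=; rewrite ?sub0set ?ts_out_sub. Qed.

Lemma restr_over w (D : {set V}) : over D (restr w D).
Proof. by move=> k; apply: subsetIr. Qed.

(** The Moore property: letter [k] is not read yet, so outputs at [k] may serve to build that
    letter. *)
Lemma visit_ext (s : tsys I O) g g' k :
  (forall m, m < k -> g m = g' m) -> visit s g k = visit s g' k.
Proof.
elim: k => //= k IH gg'; rewrite gg' // IH // => m mk; apply: gg'; exact: ltnW.
Qed.

Lemma out_at_ext (s : tsys I O) g g' k :
  (forall m, m < k -> g m = g' m) -> out_at s g k = out_at s g' k.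
Proof. by rewrite /out_at => /visit_ext->. Qed.

Lemma out_at_restr_ext (s : tsys I O) w w' k :
  (forall m, m < k -> w m = w' m) -> out_at s (restr w I) k = out_at s (restr w' I) k.
Proof. by move=> ww'; apply: out_at_ext => m mk; rewrite /restr ww'. Qed.

Lemma visit_down (s : tsys I O) g m k :
  m <= k -> visit s g m = None -> visit s g k = None.
Proof. by move=> mk; rewrite -(subnK mk); elim: (k - m) => //= d IH /IH->. Qed.

Lemma total_visit (s : total_tsys I O) g k : over I g -> isSome (visit s g k).
Proof.
by move=> gI; elim: k => //= k; case: (visit _ _ k) => //= t _; apply: ts_total.
Qed.

Lemma computation_visit (s : tsys I O) g k :
  isSome (computation s g k) = isSome (visit s g k).
Proof. by rewrite /computation; case: (visit s g k). Qed.

Lemma computationE (s : tsys I O) g k : isSome (visit s g k) ->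
  computation s g k = Some (g k :|: out_at s g k).
Proof. by rewrite /computation /out_at; case: (visit s g k). Qed.

Lemma computation_out (D : {set V}) (s : tsys I O) g k :
  I :&: O = set0 -> over I g -> D \subset O -> isSome (visit s g k) ->
  omap (fun a => a :&: D) (computation s g k) = Some (out_at s g k :&: D).
Proof.
move=> dIO gI DO vk; rewrite computationE //=; congr Some.
rewrite setIUl [X in X :|: _](_ : _ = set0) ?set0U //.
by apply/eqP; rewrite -subset0 -dIO setISS.
Qed.

End TransitionSystems.

Lemma simulated_visit (V : finType) (I O O' OG : {set V}) (s : tsys I O)
    (u : tsys I O') (g : iword V) k :
  simulated OG s u -> over I g -> isSome (visit s g k) ->
  out_at s g k :&: OG = out_at u g k :&: OG.
Proof.
case=> R [R0 Rstep] gI; rewrite /out_at.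
suff: forall t, visit s g k = Some t -> exists2 t', visit u g k = Some t' & R t t'.
  case: (visit s g k) => //= t /(_ t erefl)[t' -> Rt] _ /=.
  by have [-> _] := Rstep _ _ Rt.
elim: k => /= [t [<-]|k IH t]; first by exists (ts_init u).
case: (visit s g k) IH => //= t1 /(_ t1 erefl)[t1' -> Rt1] /= E.
by have [_ /(_ _ _ (gI k) E)] := Rstep _ _ Rt1.
Qed.

(** A run outlasts its word by at most one state, whence the bound [k.+1]. *)
Lemma fin_rejecting_of_finite (V : finType) (A : ucb_automaton V) (u : word V) k :
  (forall m, k <= m -> u m = None) -> all_runs_fin_rejecting A u.
Proof.
move=> uk r [_ rstep]; exists k.+1 => -[//|m] q km rm.
by have [q1 [a [_]]] := rstep _ _ rm; rewrite uk.
Qed.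

Lemma all_runs_fin_rejecting_ext (V : finType) (A : ucb_automaton V) (u v : word V) :
  u =1 v -> all_runs_fin_rejecting A u -> all_runs_fin_rejecting A v.
Proof.
move=> uv Au r [r0 rstep]; apply: Au; split=> // k q' /rstep[q [a [? va ?]]].
by exists q, a; rewrite uv.
Qed.

(** * Letters, valid histories and closed loops in an architecture *)

Section Architecture.
Variables (V : finType) (n : nat) (arch : architecture V n).
Implicit Types (w : iword V) (i j : 'I_n).
Local Notation Inp := (Inp arch).
Local Notation Out := (Out arch).
Local Notation Var := (Var arch).
Local Notation OutG := (OutG arch).

Lemma OutG_sub j : OutG j \subset Out j.
Proof. exact: subsetIl. Qed.

Lemma setI_OutG j (a : {set V}) : a :&: Out j :&: OutG j = a :&: OutG j.
Proof. by rewrite -setIA (setIidPr (OutG_sub j)). Qed.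

(** All infinite extensions of the history give the same outputs at [k < t], since a Moore output
    reads earlier letters only; so [w] itself can stand for them. *)
Lemma valid_history_mkseqP (J : {set 'I_n}) (G : forall j, gts arch j) w t :
  valid_history J G (mkseq w t) <->
  (forall j k, j \in J -> k < t -> w k :&: OutG j = out_at (G j) (restr w (Inp j)) k).
Proof.
have dj j : Inp j :&: OutG j = set0.
  by apply/eqP; rewrite -subset0 -(Inp_Out_disj arch j) setIS ?OutG_sub.
have outE j (u : iword V) k : omap (fun a => a :&: OutG j)
    (computation (G j) (restr u (Inp j)) k) = Some (out_at (G j) (restr u (Inp j)) k).
  rewrite computation_out ?dj //; try exact: restr_over.
    by rewrite (setIidPl (out_at_sub _ _ _)).
  by apply: total_visit; apply: restr_over.
split=> [vh j k jJ kt|H j k u jJ].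
  have := vh j k w jJ; rewrite size_mkseq nth_mkseq // outE => H.
  by apply: Some_inj; apply: H => // m mt; rewrite nth_mkseq.
rewrite size_mkseq outE => kt uw; rewrite nth_mkseq // H //; congr Some.
by apply: out_at_restr_ext => m mk; rewrite uw ?nth_mkseq // (ltn_trans mk).
Qed.

Section Letters.
Variables (i : 'I_n) (g o g' : {set V}).
Hypotheses (gI : g \subset Inp i) (oO : o \subset Out i) (gV : g' \subset ~: Var i).

Lemma letter_Inp : (g :|: o :|: g') :&: Inp i = g.
Proof.
apply/setP=> x; rewrite !inE; have /setP/(_ x) := Inp_Out_disj arch i.
have := subsetP gI x; have := subsetP oO x; have := subsetP gV x; rewrite !inE.
case: (x \in g); case: (x \in o); case: (x \in g'); case: (x \in Inp i);
  case: (x \in Out i) => //= a b c;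
  solve [by have := a isT | by have := b isT | by have := c isT].
Qed.

Lemma letter_Out : (g :|: o :|: g') :&: Out i = o.
Proof.
apply/setP=> x; rewrite !inE; have /setP/(_ x) := Inp_Out_disj arch i.
have := subsetP gI x; have := subsetP oO x; have := subsetP gV x; rewrite !inE.
case: (x \in g); case: (x \in o); case: (x \in g'); case: (x \in Inp i);
  case: (x \in Out i) => //= a b c;
  solve [by have := a isT | by have := b isT | by have := c isT].
Qed.

End Letters.

Lemma letter_split i (a : {set V}) :
  a = (a :&: Inp i) :|: (a :&: Out i) :|: (a :&: ~: Var i).
Proof.
by apply/setP=> x; rewrite !inE;
  case: (x \in a); case: (x \in Inp i); case: (x \in Out i).
Qed.

Lemma outs_Out (f : 'I_n -> {set V}) (E : {set V}) j :
  (forall j, f j \subset Out j) -> ((E :\: out arch) :|: \bigcup_j f j) :&: Out j = f j.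
Proof.
move=> fO; apply/setP=> x; rewrite !inE; apply/idP/idP => [|xf]; last first.
  by rewrite (subsetP (fO j)) // andbT; apply/orP; right; apply/bigcupP; exists j.
case/andP=> /orP[/andP[/negP nx _] xj|/bigcupP[l _ xl] xj].
  by case: nx; apply/bigcupP; exists j.
have [<- //|lj] := eqVneq l j.
by have /setP/(_ x) := Out_Out_disj arch lj; rewrite !inE xj (subsetP (fO l)).
Qed.

(* [f] is a causal (Moore) behaviour of the processes: what [f j] outputs at [m]
   depends only on the letters before [m]. *)
Lemma closed_loop (f : 'I_n -> iword V -> nat -> {set V}) w k :
  (forall j u u' m, (forall l, l < m -> u l = u' l) -> f j u m = f j u' m) ->
  (forall j u m, f j u m \subset Out j) ->
  exists2 u, forall m, m < k -> u m = w m &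
    forall j m, k <= m -> u m :&: Out j = f j u m.
Proof.
move=> fcausal fO.
(* The empty set [set0 :\: out arch] only brings the letter into the form of [outs_Out]. *)
have [u uE] := unfold_word (fun h => if size h < k then w (size h) else
  (set0 :\: out arch) :|: \bigcup_j f j (nth set0 h) (size h)).
exists u => [m mk|j m km]; rewrite uE size_mkseq; first by rewrite mk.
rewrite ltnNge km /= outs_Out //; apply: fcausal => l lm.
by rewrite nth_mkseq.
Qed.

(** * Soundness *)

Lemma wcup_truncate i (s : partial_strategy arch i) w t :
  (forall k, w k :&: Out i = out_at s (restr w (Inp i)) k) ->
  exists2 m, m <= t &
   wprefix (wcup (computation s (restr w (Inp i))) (restr w (~: Var i))) t = mkseq w m.
Proof.
move=> wO; apply: wprefix_truncate => k; last first.
  by rewrite /wcup /computation /=; case: visit.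
move=> a; rewrite /wcup /computation; have := wO k; rewrite /out_at.
by case: visit => //= t' E [<-]; rewrite [RHS](letter_split i) E.
Qed.

Lemma is_infinite_visit i (s : partial_strategy arch i) g :
  is_infinite (computation s g) <-> forall k, isSome (visit s g k).
Proof. by split=> H k; have := H k; rewrite computation_visit. Qed.

(** The premise on outputs is conditional because a parallel computation fixes them only while all
    processes are defined; the induction discharges the condition position by position. *)
Lemma solution_visit A (S : forall i, partial_strategy arch i)
    (G : forall i, gts arch i) w :
  is_solution A S G ->
  (forall k, (forall i, isSome (visit (S i) (restr w (Inp i)) k)) ->
     forall i, w k :&: Out i = out_at (S i) (restr w (Inp i)) k) ->
  forall k i, isSome (visit (S i) (restr w (Inp i)) k).
Proof.
move=> sol wO.
suff H k m : m <= k -> forall i, isSome (visit (S i) (restr w (Inp i)) m).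
  by move=> k; apply: H.
elim: k m => [m|k IH m]; first by rewrite leqn0 => /eqP->.
rewrite leq_eqVlt => /orP[/eqP-> i|]; last exact: IH.
have wO' m' : m' <= k -> forall j, w m' :&: Out j = out_at (S j) (restr w (Inp j)) m'.
  by move=> /IH; apply: wO.
have wG m' j : m' <= k -> w m' :&: OutG j = out_at (G j) (restr w (Inp j)) m'.
  move=> mk; have [_ sim _] := sol j.
  have := simulated_visit sim (@restr_over _ w (Inp j)) (IH _ mk j).
  rewrite (setIidPl (out_at_sub _ _ _)) => <-.
  by rewrite -wO' // setI_OutG.
(* For [j != i] only outputs in [OutG j] are produced; after [k] the other outputs of these
   processes are off. *)
pose f j (u : iword V) m := if j == i then out_at (S i) (restr u (Inp i)) m
                            else out_at (G j) (restr u (Inp j)) m.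
have [||u uw uf] := @closed_loop f w k.+1.
- move=> j u u' l uu'; rewrite /f; case: eqP => _; exact: out_at_restr_ext.
- move=> j u l; rewrite /f; case: eqP => [->|_]; first exact: out_at_sub.
  exact: subset_trans (out_at_sub _ _ _) (OutG_sub j).
have uO l : u l :&: Out i = out_at (S i) (restr u (Inp i)) l.
  have [lk|/uf->] := ltnP l k.+1; last by rewrite /f eqxx.
  rewrite uw // wO' //; apply: out_at_restr_ext => p pl.
  by rewrite uw // (ltn_trans pl).
have uG j l : j != i -> u l :&: OutG j = out_at (G j) (restr u (Inp j)) l.
  move=> ji; have [lk|kl] := ltnP l k.+1.
    rewrite uw // wG //; apply: out_at_restr_ext => p pl.
    by rewrite uw // (ltn_trans pl).
  have := uf j l kl; rewrite /f (negbTE ji) => E.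
  rewrite -setI_OutG E; apply/setIidPl; exact: out_at_sub.
have [loc _ _] := sol i.
have /loc[_ inf] := @restr_over _ u (Inp i).
have: is_infinite (computation (S i) (restr u (Inp i))).
  apply: inf; exists (restr u (~: Var i)); first exact: restr_over.
  (* Should [S i] stop, the combined word is a finite prefix of [u], hence still valid. *)
  move=> t; have [p _ ->] := wcup_truncate t uO.
  by apply/valid_history_mkseqP => j l; rewrite !inE => /uG.
(* The state at [k.+1] reads the letters up to [k], where [u] and [w] agree. *)
move/is_infinite_visit/(_ k.+1); rewrite (@visit_ext _ _ _ _ _ (restr w (Inp i))) //.
by move=> l lk; rewrite /restr uw.
Qed.

Lemma solution_models (xs : seq (ltl V)) (A : 'I_n -> ucb_automaton V)
    (S : forall i, partial_strategy arch i) (G : forall i, gts arch i) :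
  0 < n -> (forall i, same_language (A i) (component arch xs i)) ->
  is_solution A S G -> par_models S (conjs xs).
Proof.
move=> n_gt0 A_lang sol g _ sg [w wE].
have wO k : (forall i, isSome (visit (S i) (restr w (Inp i)) k)) ->
    forall i, w k :&: Out i = out_at (S i) (restr w (Inp i)) k.
  move=> vk i; have := wE k; case: ifP => [_ [_ _ /(_ i)]|/negP[]].
    rewrite computation_out ?Inp_Out_disj //; last exact: restr_over.
    by case=> ->; apply/setIidPl/out_at_sub.
  by apply/forallP => j; rewrite computation_visit.
have vis := solution_visit sol wO.
exists w => [k|].
  have := wE k; case: ifP => [_ []//|/negP[]].
  by apply/forallP => j; rewrite computation_visit.
pose p i x := (prop x :&: Out i != set0) || (prop x :&: out arch == set0).
apply: (sat_conjs_cover (p := p)) => [x|i]; last first.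
  apply/A_lang; have [_ _ acc] := sol i.
  have := acc _ _ (@restr_over _ w (Inp i)) (@restr_over _ w (~: Var i)).
  apply: all_runs_fin_rejecting_ext => k.
  rewrite /wcup computationE //= -wO // /inf_word; congr Some.
  by rewrite [RHS](letter_split i).
(* A conjunct without outputs belongs to every component, so any index will do; otherwise the owner
   of one of its outputs serves. *)
have [xout|/set0Pn[v]] := eqVneq (prop x :&: out arch) set0.
  by exists (Ordinal n_gt0); rewrite /p xout eqxx orbT.
rewrite inE => /andP[vx /bigcupP[i _ vi]]; exists i.
by apply/orP; left; apply/set0Pn; exists v; rewrite inE vx.
Qed.

(** * Completeness *)

Section Completeness.
Variable S : forall i, strategy arch i.

Lemma gts_out_sub i (t : ts_state (S i)) : ts_out t :&: OutG i \subset OutG i.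
Proof. exact: subsetIr. Qed.

Definition gts_ts i : tsys (Inp i) (OutG i) :=
  @Tsys V _ _ _ (ts_init (S i)) (@ts_step _ _ _ (S i)) _ (@gts_out_sub i).

Lemma gts_total i (t : ts_state (gts_ts i)) (a : {set V}) :
  a \subset Inp i -> isSome (ts_step t a).
Proof. exact: ts_total. Qed.

Definition gts_of i : gts arch i := TotalTsys (@gts_total i).

Lemma gts_visit i g k : visit (gts_of i) g k = visit (S i) g k.
Proof. by elim: k => //= k ->. Qed.

Lemma gts_out_at i g k : out_at (gts_of i) g k = out_at (S i) g k :&: OutG i.
Proof. by rewrite /out_at gts_visit; case: visit => //=; rewrite set0I. Qed.

Definition joint_state := {dffun forall j, ts_state (S j)}.

(* [x] has a joint transition to [y] on a letter that looks like [a] to [p_i] and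
   that may be the next letter of a history valid for the processes other
   than [p_i]. *)
Definition joint_step i (a : {set V}) (x y : joint_state) : bool :=
  [exists b : {set V},
    [&& b :&: Inp i == a, b :&: Out i == ts_out (x i),
        [forall j, (j != i) ==> (b :&: OutG j == ts_out (x j) :&: OutG j)] &
        [forall j, ts_step (x j) (b :&: Inp j) == Some (y j)]]].

Definition joint_post i (X : {set joint_state}) (a : {set V}) : {set joint_state} :=
  [set y | [exists x in X, joint_step i a x y]].

Definition joint_init : joint_state := [ffun j => ts_init (S j)].

Definition restriction_step i (t : ts_state (S i) * {set joint_state}) (a : {set V}) :=
  if joint_post i t.2 a == set0 then None
  else omap (fun t' => (t', joint_post i t.2 a)) (ts_step t.1 a).

(* Whether a transition must be removed depends on the history of [p_i], hence the
   subset construction: the second component of a state collects the joint states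
   compatible with that history. *)
Definition restriction i : partial_strategy arch i :=
  @Tsys V _ _ _ (ts_init (S i), [set joint_init]) (@restriction_step i) _
       (fun t => ts_out_sub t.1).

(** Valid histories as seen by [p_i], phrased through the strategies instead of [gts_of] so that
    joint runs can be read off. *)
Definition consistent i g k w :=
  (forall m, m < k -> w m :&: Inp i = g m /\ w m :&: Out i = out_at (S i) g m) /\
  (forall j m, j != i -> m < k ->
     w m :&: OutG j = out_at (S j) (restr w (Inp j)) m :&: OutG j).

(** The subset construction continued on all inputs, even where [restriction i] has stopped. *)
Definition joint_reach i g k : {set joint_state} :=
  iteri k (fun m X => joint_post i X (g m)) [set joint_init].

Lemma restriction_visit i g k t X :
  visit (restriction i) g k = Some (t, X) ->
  visit (S i) g k = Some t /\ X = joint_reach i g k.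
Proof.
elim: k t X => [t X [<- <-]//|k IH t X] /=.
case: (visit (restriction i) g k) IH => //= -[t1 X1] /(_ _ _ erefl)[-> ->] /=.
rewrite /restriction_step /=; case: ifP => // _.
by case: (ts_step t1 (g k)) => //= t2 [<- <-].
Qed.

(** Correctness of the subset construction: a joint transition appends a letter to a consistent
    word, and conversely the last letter of a consistent word witnesses the last transition. *)
Lemma joint_reachP i g k (x : joint_state) : over (Inp i) g ->
  x \in joint_reach i g k <->
  exists2 w, consistent i g k w &
    forall j, visit (S j) (restr w (Inp j)) k = Some (x j).
Proof.
move=> gI; elim: k x => [|k IH] x.
  rewrite /joint_reach /= inE; split=> [/eqP->|[w _ wx]].
    by exists (fun=> set0) => // j; rewrite ffunE.
  by apply/eqP/ffunP => j; rewrite ffunE; have [] := wx j.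
rewrite /joint_reach /= -/(joint_reach i g k) inE; split; last first.
  case=> w [wi wG] wx; have wvis j := @total_visit _ _ _ (S j) _ k (@restr_over _ w (Inp j)).
  (* The strategies are total, so [w] passes through a joint state at [k]. *)
  have [y wy] : exists y : joint_state,
      forall j, visit (S j) (restr w (Inp j)) k = Some (y j).
    have ex j : exists t, visit (S j) (restr w (Inp j)) k = Some t.
      by have := wvis j; case: visit => // t; exists t.
    by have [f fP] := fin_all_exists ex; exists [ffun j => f j] => j; rewrite ffunE.
  apply/existsP; exists y; apply/andP; split.
    apply/IH; exists w => //; split=> [m mk|j m ji mk]; first exact: wi (ltnW _).
    exact: wG ji (ltnW _).
  apply/existsP; exists (w k); have [-> ->] := wi k (ltnSn k).
  apply/and4P; split=> //.
  - rewrite /out_at (@visit_ext _ _ _ _ _ (restr w (Inp i))) ?wy // => m mk.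
    by have [<-] := wi m (ltnW mk).
  - by apply/forallP => j; apply/implyP => ji; rewrite wG // /out_at wy.
  - by apply/forallP => j; have := wx j; rewrite /= wy /= => ->.
case/existsP => y /andP[/IH[w [wi wG] wy] /existsP[b /and4P[/eqP bI /eqP bO]]].
move=> /forallP bG /forallP bstep.
(* Overwriting letter [k] leaves all visits up to [k] unchanged. *)
pose u m := if m == k then b else w m.
have uw m : m < k -> u m = w m by rewrite /u; case: ltngtP.
have uk : u k = b by rewrite /u eqxx.
have uvis j m : m <= k -> visit (S j) (restr u (Inp j)) m = visit (S j) (restr w (Inp j)) m.
  by move=> mk; apply: visit_ext => l lm; rewrite /restr uw // (leq_trans lm).
exists u; last by move=> j; rewrite /= uvis // wy /= /restr uk; apply/eqP.
split=> [m|j m ji]; rewrite ltnS leq_eqVlt => /orP[/eqP->|mk].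
- rewrite uk bI bO; split=> //; rewrite /out_at.
  rewrite (@visit_ext _ _ _ _ _ (restr w (Inp i))) ?wy // => l lk.
  by have [<-] := wi l lk.
- by rewrite uw //; apply: wi.
- rewrite uk /out_at uvis // wy /=; apply/eqP.
  by have /implyP := bG j; apply.
- by rewrite uw // wG // /out_at uvis // ltnW.
Qed.

Lemma joint_reach_neq0 i g k : over (Inp i) g ->
  joint_reach i g k != set0 <-> exists w, consistent i g k w.
Proof.
move=> gI; split=> [/set0Pn[x /joint_reachP[]//]|[w wc]]; first by move=> w; exists w.
have ex j : exists t, visit (S j) (restr w (Inp j)) k = Some t.
  have := @total_visit _ _ _ (S j) _ k (@restr_over _ w (Inp j)).
  by case: visit => // t; exists t.
have [f fP] := fin_all_exists ex; apply/set0Pn; exists ([ffun j => f j] : joint_state).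
by apply/joint_reachP => //; exists w => // j; rewrite ffunE.
Qed.

(** Since [S i] is total, a transition is missing only if it would empty the set of joint states. *)
Lemma restriction_visitS i g k : over (Inp i) g ->
  isSome (visit (restriction i) g k) ->
  isSome (visit (restriction i) g k.+1) = (joint_reach i g k.+1 != set0).
Proof.
move=> gI /=; case E: (visit (restriction i) g k) => [[t X]|] //= _.
have [_ ->] := restriction_visit E; rewrite /restriction_step /=.
rewrite {2}/joint_reach /= -/(joint_reach i g k); case: eqP => //= _.
by have := ts_total t (gI k); case: ts_step.
Qed.

Lemma consistent_valid i g w k :
  (forall m, m < k -> w m :&: Inp i = g m /\ w m :&: Out i = out_at (S i) g m) ->
  valid_history [set~ i] gts_of (mkseq w k) <-> consistent i g k w.
Proof.
move=> wi; rewrite valid_history_mkseqP; split=> [H|[_ H] j m].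
  by split=> // j m ji mk; rewrite H ?inE // gts_out_at.
by rewrite !inE => ji mk; rewrite gts_out_at H.
Qed.

(** Inputs and outputs are disjoint, so equal trace letters have equal outputs; this gives access to
    an arbitrary restriction through its traces. *)
Lemma prefix_out_at i (s s' : partial_strategy arch i) g k :
  over (Inp i) g -> isSome (visit s' g k) ->
  prefix_word (computation s' g) (computation s g) ->
  isSome (visit s g k) /\ out_at s' g k = out_at s g k.
Proof.
move=> gI vis' /(_ k); rewrite computationE // => /(_ _ erefl) E.
have vis : isSome (visit s g k) by rewrite -computation_visit E.
split=> //; have := computation_out (Inp_Out_disj arch i) gI (subxx _) vis.
rewrite E /= => -[]; rewrite (setIidPl (out_at_sub s _ _)) => <-.
have := computation_out (Inp_Out_disj arch i) gI (subxx _) vis'.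
by rewrite computationE //= => -[->]; apply/esym/setIidPl/out_at_sub.
Qed.

Lemma over_letter i g g' : over (Inp i) g -> over (~: Var i) g' ->
  let w k := g k :|: out_at (S i) g k :|: g' k in
  forall k, w k :&: Inp i = g k /\ w k :&: Out i = out_at (S i) g k.
Proof.
move=> gI gV w k; have oO := out_at_sub (S i) g k.
by rewrite (letter_Inp (gI k) oO (gV k)) (letter_Out (gI k) oO (gV k)).
Qed.

Lemma wprefix_restriction i (s' : partial_strategy arch i) g g' k :
  over (Inp i) g -> prefix_word (computation s' g) (computation (S i) g) ->
  (forall m, m < k -> isSome (visit s' g m)) ->
  wprefix (wcup (computation s' g) g') k =
    mkseq (fun m => g m :|: out_at (S i) g m :|: g' m) k.
Proof.
move=> gI pre vis; apply: wprefix_mkseq => m mk; rewrite /wcup computationE ?vis //=.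
by have [_ ->] := prefix_out_at gI (vis _ mk) pre.
Qed.

Lemma restriction_prefix i g :
  prefix_word (computation (restriction i) g) (computation (S i) g).
Proof.
move=> k a; rewrite /computation.
by case E: (visit (restriction i) g k) => [[t X]|] //=; have [-> _] := restriction_visit E.
Qed.

Lemma koenig_consistent i g : (forall k, exists w, consistent i g k w) ->
  exists w, forall k, consistent i g k w.
Proof.
apply: koenig => [k w [wi wG]|k w w' ww' [wi wG]].
  by split=> [m mk|j m ji mk]; [apply: wi|apply: wG] => //; apply: ltnW.
split=> [m mk|j m ji mk]; first by rewrite -ww' //; apply: wi.
rewrite -ww' // wG //; congr (_ :&: _); apply: out_at_restr_ext => l lm.
by rewrite ww' // (ltn_trans lm).
Qed.

Lemma restriction_local i : local_strategy [set~ i] gts_of (restriction i).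
Proof.
move=> g gI; rewrite is_infinite_visit; split=> [vis|[g' gV valid]].
  have [k|w wc] := @koenig_consistent i g.
    (* Visits are tied to consistency only at successor positions, so a consistent word of length
       [k.+1] is cut down to [k]. *)
    have := vis k.+1; rewrite restriction_visitS // => /joint_reach_neq0-/(_ gI)[w [wi wG]].
    by exists w; split=> [m mk|j m ji mk]; [apply: wi|apply: wG] => //; apply: ltnW.
  exists (restr w (~: Var i)); first exact: restr_over.
  move=> k; have [wi _] := wc k.
  rewrite (wprefix_restriction _ gI (@restriction_prefix i g)) //.
  rewrite (_ : mkseq _ _ = mkseq w k); first by apply/(consistent_valid wi).
  apply/eq_in_map => m; rewrite mem_iota add0n => /wi[<- <-].
  by rewrite -letter_split.
have wi := over_letter gI gV.
suff H k m : m <= k -> isSome (visit (restriction i) g m) by move=> k; apply: H.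
elim: k m => [m|k IH m]; first by rewrite leqn0 => /eqP->.
rewrite leq_eqVlt => /orP[/eqP->|]; last exact: IH.
rewrite restriction_visitS ?IH //; apply/joint_reach_neq0 => //.
(* The given valid word, up to length [k.+1], is itself the consistent word that keeps the next
   transition. *)
eexists; apply/(consistent_valid (fun m _ => wi m)).
by rewrite -(wprefix_restriction _ gI (@restriction_prefix i g)).
Qed.

Lemma restriction_is_restriction i : is_restriction gts_of (S i) (restriction i).
Proof.
split; [|by move=> g _; apply: restriction_prefix|exact: restriction_local].
exists fst; split=> // t a t' aI /=; rewrite /restriction_step; case: ifP => // _.
by case: (ts_step t.1 a) => //= t1 [<-].
Qed.

(* The guarantees only fix the outputs read by some process; the other outputs can be
   corrected without any process noticing, which turns the word into a computation of
   the parallel composition. *)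
Lemma parallel_word w :
  (forall j k, w k :&: OutG j = out_at (S j) (restr w (Inp j)) k :&: OutG j) ->
  exists u, [/\ forall j k, u k :&: Inp j = w k :&: Inp j,
    forall j k, u k :&: Out j = out_at (S j) (restr w (Inp j)) k &
    par_computation S (restr u (Oenv arch)) (inf_word u)].
Proof.
move=> wG; pose f k j := out_at (S j) (restr w (Inp j)) k.
have fO k j : f k j \subset Out j by apply: out_at_sub.
pose u : iword V := fun k => (w k :\: out arch) :|: \bigcup_j f k j.
have uO j k : u k :&: Out j = f k j by apply: outs_Out.
have uI j k : u k :&: Inp j = w k :&: Inp j.
  apply/setP=> x; rewrite [LHS]inE [RHS]inE; case xj: (x \in Inp j); rewrite ?andbF //.
  (* A non-output is copied from [w]; an output of [p_l] read by [p_j] lies in [OutG l], where [w]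
     already agrees with [S l]. *)
  rewrite !andbT; have [xout|xout] := boolP (x \in out arch); last first.
    rewrite !inE xout orbC; case: bigcupP => //= -[l _ xl].
    by case/bigcupP: xout; exists l => //; apply: (subsetP (fO k l)).
  have /bigcupP[l _ xl] := xout.
  have xG : x \in OutG l by rewrite inE xl; apply/bigcupP; exists j.
  have <- : (x \in u k :&: Out l) = (x \in u k) by rewrite in_setI xl andbT.
  have <- : (x \in w k :&: OutG l) = (x \in w k) by rewrite in_setI xG andbT.
  by rewrite uO wG in_setI xG andbT.
exists u; split=> //; exists u => k.
have uvis j : isSome (visit (S j) (restr u (Inp j)) k).
  by apply: total_visit; apply: restr_over.
case: ifP => [_|/negP[]]; last by apply/forallP => j; rewrite computation_visit.
split=> // j; rewrite computation_out ?Inp_Out_disj //; last exact: restr_over.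
rewrite (setIidPl (out_at_sub _ _ _)) uO; congr Some.
by apply: out_at_ext => m _; rewrite /restr uI.
Qed.

Lemma restrictions_solution (xs : seq (ltl V)) (A : 'I_n -> ucb_automaton V)
    (S' : forall i, partial_strategy arch i) :
  (forall i, same_language (A i) (component arch xs i)) ->
  par_models S (conjs xs) ->
  (forall i, prop (component arch xs i) \subset Var i) ->
  (forall i, is_restriction gts_of (S i) (S' i)) ->
  is_solution A S' gts_of.
Proof.
move=> A_lang models propV restrS i.
have [[h [h_init h_out h_step]] pre loc] := restrS i; split=> //.
  (* The guarantee has the states of [S i], so the graph of the copy map is a simulation. *)
  exists (fun t u => h t = u); split=> // t u <-; split=> [|a t' aI tt'].
    by rewrite h_out /= -setIA setIid.
  by exists (h t') => //; apply: h_step.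
move=> g g' gI gV; have [inf|fin] := classic (is_infinite (computation (S' i) g)).
  have /loc[/(_ inf)[g1 g1V valid] _] := gI.
  have /is_infinite_visit vis := inf.
  have w1i := over_letter gI g1V; set w1 := (fun k => _) in w1i.
  have w1G j k : w1 k :&: OutG j = out_at (S j) (restr w1 (Inp j)) k :&: OutG j.
    (* [valid] does not constrain [p_i], whose own guarantee holds because [w1] carries the outputs
       of [S i]. *)
    have [->|ji] := eqVneq j i.
      rewrite -setI_OutG; have [_ ->] := w1i k; congr (_ :&: _).
      by apply: out_at_ext => m _; have [<-] := w1i m.
    have := valid k.+1; rewrite (wprefix_restriction _ gI (pre g gI)) // -/w1.
    by case/(consistent_valid (fun m _ => w1i m)) => _; apply.
  have [u [uI uO par_u]] := parallel_word w1G.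
  have [v uv sat_v] := models _ (@restr_over _ u (Oenv arch)) _ par_u.
  (* [w] carries the given letters outside [Var i], [w1] the witnessing ones; they agree on [Var i],
     which is all that the component sees. *)
  have wi := over_letter gI gV; set w := (fun k => _) in wi.
  have acc : accepts (A i) w.
    apply/A_lang; apply/(@sat_at_agree _ (Var i) _ v) => [k|//|].
      have [<-] : inf_word u k = inf_word v k := uv k.
      rewrite /Var !setIUr; have [-> ->] := wi k; rewrite uI uO.
      have [-> _] := w1i k; congr (_ :|: _).
      by apply: out_at_ext => m _; have [<-] := w1i m.
    exact: sat_conjs_filter.
  apply: all_runs_fin_rejecting_ext acc => k; rewrite /wcup computationE //=.
  by have [_ ->] := prefix_out_at gI (vis k) (pre g gI).
have [k kP] := not_all_ex_not _ _ fin.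
apply: (@fin_rejecting_of_finite _ _ _ k) => m km; rewrite /wcup /computation.
move: kP; rewrite computation_visit; case E: (visit _ _ k) => [t|] // _.
by rewrite (visit_down km E).
Qed.

End Completeness.

End Architecture.

Theorem theorem5 (V : finType) (n : nat) (n_ge2 : 1 < n)
    (arch : architecture V n)
    (phi : ltl V) (xs : seq (ltl V)) (phi_conj : phi = conjs xs)
    (A : 'I_n -> ucb_automaton V)
    (A_lang : forall i, same_language (A i) (component arch xs i)) :
  (forall (G : forall i, gts arch i) (S : forall i, partial_strategy arch i),
     (forall i, local_strategy [set~ i] G (S i)) ->
     is_solution A S G ->
     par_models S phi)
  /\
  (forall S : forall i, strategy arch i,
     par_models (fun i => total_ts (S i)) phi ->
     (forall i, prop (component arch xs i) \subset Var arch i) ->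
     exists G : forall i, gts arch i,
       (exists S' : forall i, partial_strategy arch i,
          forall i, is_restriction G (S i) (S' i)) /\
       (forall S' : forall i, partial_strategy arch i,
          (forall i, is_restriction G (S i) (S' i)) ->
          is_solution A S' G)).
Proof.
rewrite phi_conj; split=> [G S _|S models propV].
  exact: solution_models (ltnW n_ge2) A_lang.
exists (gts_of S); split.
  by exists (restriction S) => i; apply: restriction_is_restriction.
by move=> S'; apply: restrictions_solution A_lang models propV.
Qed.
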